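(* Let $L\subset\mathbb{R}^n$ be an $n$-dimensional lattice, let $B=[b_1|\dots|b_n]^t$ be a basis of $L$, and write $B=D\cdot V$ where $D=\mathrm{diag}(\|b_1\|,\dots,\|b_n\|)$. Let $U=VV^t$, a symmetric positive definite matrix, and let $\lambda_1,\dots,\lambda_n>0$ be its eigenvalues (counted with multiplicity). Then $$S(B)=\mathrm{tr}(U^{-1})=\sum_{i=1}^n\frac{1}{\lambda_i},$$ where $S(B)$ is the Seysen measure of $B$.
   Context: An $n$-dimensional lattice $L\subset\mathbb{R}^n$ is a set $L=\{\sum_{i=1}^n a_i b_i : a_i\in\mathbb{Z}\}$ with $b_1,\dots,b_n\in\mathbb{R}^n$ linearly independent over $\mathbb{R}$. A basis of $L$ is identified with the matrix $B=[b_1|\dots|b_n]^t$ whose rows $b_i$ are linearly independent and generate $L$ over $\mathbb{Z}$. The dual basis is $B^*=(B^{-1})^t=[b_1^*|\dots|b_n^*]^t$, so that $\langle b_i,b_j^*\rangle=\delta_{i,j}$. The Seysen measure of $B$ is $S(B)=\sum_{i=1}^n\|b_i\|^2\,\|b_i^*\|^2$, where $\|\cdot\|$ is the Euclidean norm on vectors. Equivalently to the definition above, $U=(\cos\theta_{ij})_{i,j}$, where $\theta_{ij}$ is the angle between $b_i$ and $b_j$. *)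

(* Defs.v *)
From mathcomp Require Import all_boot all_order all_algebra.
From mathcomp Require Import sesquilinear classical_sets reals.

Set Implicit Arguments.
Unset Strict Implicit.
Unset Printing Implicit Defensive.

Import Order.TTheory GRing.Theory Num.Theory.
Local Open Scope ring_scope.
Local Open Scope classical_set_scope.

(* The library norm `|v| on row vectors is the sup norm, hence this one. *)
Definition enorm (R : realType) (n : nat) (v : 'rV[R]_n) : R :=
  Num.sqrt (\sum_(j < n) v 0 j ^+ 2).

Definition int_row_span (R : realType) (n : nat) (B : 'M[R]_n) : set 'rV[R]_n :=
  [set x | exists a : 'I_n -> int, x = \sum_(i < n) (a i)%:~R *: row i B].

Definition lattice_basis (R : realType) (n : nat)
    (L : set 'rV[R]_n) (B : 'M[R]_n) : Prop :=
  row_free B /\ L = int_row_span B.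

Definition full_lattice (R : realType) (n : nat) (L : set 'rV[R]_n) : Prop :=
  exists B : 'M[R]_n, lattice_basis L B.

Definition dual_basis (R : realType) (n : nat) (B : 'M[R]_n) : 'M[R]_n :=
  (invmx B)^T.

Definition seysen (R : realType) (n : nat) (B : 'M[R]_n) : R :=
  \sum_(i < n) enorm (row i B) ^+ 2 * enorm (row i (dual_basis B)) ^+ 2.

Definition row_norm_mx (R : realType) (n : nat) (B : 'M[R]_n) : 'M[R]_n :=
  diag_mx (\row_(i < n) enorm (row i B)).

Definition posdefmx (R : realType) (n : nat) (A : 'M[R]_n) : Prop :=
  A \is symmetricmx /\
  forall x : 'rV[R]_n, x != 0 -> 0 < (x *m A *m x^T) 0 0.

(* The family lam lists all n eigenvalues of A, each repeated according to its
   algebraic multiplicity. *)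
Definition eigenvalues_of (R : realType) (n : nat)
    (A : 'M[R]_n) (lam : 'I_n -> R) : Prop :=
  char_poly A = \prod_(i < n) ('X - (lam i)%:P).

(* Main.v *)
(* As [B] is invertible, so are [D] and [V], and [D (B^-1)^t = (V^-1)^t]; the
   [i]-th summand of [S(B)] is therefore the squared norm of the [i]-th row of
   [(V^-1)^t], that is, the [i]-th diagonal entry of
   [(V^-1)^t V^-1 = U^-1].  The second equality is the spectral theorem: over
   the complex numbers [U] is unitarily similar to a diagonal matrix with real
   entries. *)
Require Import Defs.
From mathcomp Require Import all_boot all_order all_algebra.
From mathcomp Require Import sesquilinear spectral classical_sets reals.
From mathcomp Require Import complex.

Import Order.TTheory GRing.Theory Num.Theory.
Local Open Scope ring_scope.
Local Open Scope classical_set_scope.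

Lemma mulmx1_invmx (R : comUnitRingType) (n : nat) (A B : 'M[R]_n) :
  A *m B = 1%:M -> invmx A = B.
Proof.
by move=> AB; have [Au _] := mulmx1_unit AB; rewrite -[RHS](mulKmx Au) AB mulmx1.
Qed.

(** Scalar matrices commute with [P], so [X - P^-1 A P = P^-1 (X - A) P] over the polynomials, and
    the two outer determinants cancel. *)
Lemma char_poly_conj (F : fieldType) (n : nat) (P A : 'M[F]_n) :
  P \in unitmx -> char_poly (invmx P *m A *m P) = char_poly A.
Proof.
move=> Pu; rewrite /char_poly.
have -> : char_poly_mx (invmx P *m A *m P) =
    map_mx polyC (invmx P) *m char_poly_mx A *m map_mx polyC P.
  rewrite /char_poly_mx mulmxBr mulmxBl !map_mxM; congr (_ - _).
  by rewrite scalar_mxC -mulmxA -map_mxM mulVmx // map_mx1 mulmx1.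
rewrite !det_mulmx mulrAC -det_mulmx -map_mxM mulVmx //.
by rewrite map_mx1 det1 mul1r.
Qed.

Lemma char_poly_diag (F : fieldType) (n : nat) (d : 'rV[F]_n) :
  char_poly (diag_mx d) = \prod_(i < n) ('X - (d 0 i)%:P).
Proof.
rewrite char_poly_trig ?diag_mx_is_trig //.
by apply: eq_bigr => i _; rewrite mxE eqxx mulr1n.
Qed.

(** The inverse is the same conjugate of the diagonal matrix of inverses, and the trace is
    cyclic. *)
Lemma mxtrace_invmx_conj_diag (F : fieldType) (n : nat) (P : 'M[F]_n)
    (d : 'rV[F]_n) :
  P \in unitmx -> (forall i, d 0 i != 0) ->
  \tr (invmx (invmx P *m diag_mx d *m P)) = \sum_(i < n) (d 0 i)^-1.
Proof.
move=> Pu d0; pose e : 'rV_n := \row_i (d 0 i)^-1.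
have de : diag_mx d *m diag_mx e = 1%:M.
  rewrite mulmx_diag; apply/matrixP=> i j; rewrite !mxE divff //.
have PdeP : invmx P *m diag_mx d *m P *m (invmx P *m diag_mx e *m P) = 1%:M.
  rewrite !mulmxA mulmxK // -[_ *m diag_mx d *m _]mulmxA de mulmx1.
  by rewrite mulVmx.
rewrite (mulmx1_invmx _ _ _ _ PdeP).
rewrite mxtrace_mulC mulmxA mulmxV // mul1mx mxtrace_diag.
by apply: eq_bigr => i _; rewrite mxE.
Qed.

Lemma symmetricmxE (R : fieldType) (n : nat) (A : 'M[R]_n) :
  (A \is symmetricmx) = (A == A^T).
Proof. by rewrite is_hermitianmxE expr0 scale1r map_mx_id. Qed.

Lemma symmetric_diagonalizable (R : rcfType) (n : nat) (A : 'M[R]_n) :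
  A \is symmetricmx ->
  exists (P : 'M[R[i]]_n) (d : 'rV[R]_n),
    [/\ P \in unitmx,
        map_mx (real_complex R) A =
          invmx P *m diag_mx (map_mx (real_complex R) d) *m P
      & char_poly A = \prod_(i < n) ('X - (d 0 i)%:P)].
Proof.
move=> Asym; set C := map_mx (real_complex R) A.
have Creal : C \is a realmx.
  by apply/mxOverP=> i j; rewrite mxE complex_real.
have Csym : C \is symmetricmx.
  by move: Asym; rewrite !symmetricmxE map_trmx => /eqP <-.
have /orthomx_spectralP CE := symmetric_normalmx Csym Creal.
have dreal := hermitian_spectral_diag_real (realsym_hermsym Csym Creal).
pose d := map_mx (@complex.Re R) (spectral_diag C).
have dE : map_mx (real_complex R) d = spectral_diag C.
  apply/matrixP=> i j; rewrite !mxE.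
  by rewrite RRe_real //; apply: (mxOverP dreal).
exists (spectralmx C), d; split; rewrite ?dE //; first exact: spectral_unit.
(* The factorization over [R] is checked in [R[i]], where the conjugation by [P] makes sense. *)
apply: (map_poly_inj (real_complex R)).
rewrite map_char_poly -/C CE char_poly_conj ?spectral_unit //.
rewrite char_poly_diag -dE map_prod_XsubC.
by apply: eq_bigr => i _; rewrite mxE.
Qed.

Lemma mxtrace_invmx_symmetric (R : rcfType) (n : nat) (A : 'M[R]_n)
    (lam : 'I_n -> R) :
  A \is symmetricmx ->
  A \in unitmx ->
  char_poly A = \prod_(i < n) ('X - (lam i)%:P) ->
  \tr (invmx A) = \sum_(i < n) (lam i)^-1.
Proof.
move=> /symmetric_diagonalizable[P [d [Pu AE Ad]]] Au Alam.
(* Two splittings of one polynomial into monic linear factors agree up to order, so [lam] may be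
   replaced by [d]. *)
have lam_d : perm_eq (map lam (index_enum 'I_n)) (map (d 0) (index_enum 'I_n)).
  by apply: prod_XsubC_eq; rewrite !big_map -Alam -Ad.
have d0 i : d 0 i != 0.
  apply: contraTneq Au => di0; rewrite unitmxE unitfE negbK.
  (* A zero eigenvalue would kill the constant coefficient, which is the determinant up to sign. *)
  have : (char_poly A).[0] = 0.
    by rewrite Ad horner_prod (bigD1 i) //= di0 hornerXsubC subrr mul0r.
  rewrite horner_coef0 char_poly_det => /eqP.
  by rewrite mulf_eq0 expf_eq0 oppr_eq0 oner_eq0 andbF.
rewrite -[RHS](big_map lam xpredT (fun x => x^-1)) (perm_big _ lam_d) big_map.
apply: (@complexI R); rewrite -[LHS]trace_map_mx map_invmx AE.
rewrite mxtrace_invmx_conj_diag //; last first.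
  by move=> i; rewrite mxE fmorph_eq0.
by rewrite rmorph_sum; apply: eq_bigr => i _; rewrite mxE fmorphV.
Qed.

Lemma mulmx_tr_diag (R : pzRingType) (m n : nat) (A : 'M[R]_(m, n)) (i : 'I_m) :
  (A *m A^T) i i = \sum_(j < n) A i j ^+ 2.
Proof. by rewrite mxE; apply: eq_bigr => j _; rewrite mxE expr2. Qed.

Lemma enorm_sqr (R : realType) (n : nat) (v : 'rV[R]_n) :
  enorm v ^+ 2 = \sum_(j < n) v 0 j ^+ 2.
Proof. by rewrite sqr_sqrtr // sumr_ge0 // => j _; apply: sqr_ge0. Qed.

(** The quadratic form at [x] is the squared norm of [x V], a nonzero vector when [x] is. *)
Lemma posdefmx_mulmx_tr (R : realType) (n : nat) (V : 'M[R]_n) :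
  V \in unitmx -> posdefmx (V *m V^T).
Proof.
move=> Vu; split; first by rewrite symmetricmxE trmx_mul trmxK.
move=> x x0; rewrite mulmxA -mulmxA -trmx_mul mulmx_tr_diag.
have [j xVj] : exists j, (x *m V) 0 j != 0.
  apply/existsP; apply: contraNT x0 => /existsPn xV0.
  rewrite -[x](mulmxK Vu); suff -> : x *m V = 0 by rewrite mul0mx.
  by apply/rowP=> j; rewrite [RHS]mxE; apply/eqP; rewrite -[_ == _]negbK xV0.
rewrite (bigD1 j) //= ltr_pwDl ?exprn_even_gt0 //.
by rewrite sumr_ge0 // => k _; apply: sqr_ge0.
Qed.

(** At an eigenvector [v] the form takes the value [a] times the squared norm of [v]. *)
Lemma posdefmx_eigenvalue_gt0 (R : realType) (n : nat) (A : 'M[R]_n) (a : R) :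
  posdefmx A -> eigenvalue A a -> 0 < a.
Proof.
move=> [_ Apos] /eigenvalueP[v vA v0].
have := Apos v v0; rewrite vA -scalemxAl mxE mulmx_tr_diag => av.
have v_ge0 : 0 <= \sum_(j < n) v 0 j ^+ 2.
  by rewrite sumr_ge0 // => j _; apply: sqr_ge0.
by rewrite ltNge; apply: contraL av => a0; rewrite -leNgt mulr_le0_ge0.
Qed.

Lemma seysen_mxtrace (R : realType) (n : nat) (B V : 'M[R]_n) :
  B \in unitmx -> B = row_norm_mx B *m V ->
  V \in unitmx /\ seysen B = \tr (invmx (V *m V^T)).
Proof.
move=> Bu BE; set D := row_norm_mx B in BE.
(* From [D (V B^-1) = 1], as a one-sided inverse of a square matrix is two-sided. *)
have VBD : V *m (invmx B *m D) = 1%:M.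
  by rewrite mulmxA; apply: mulmx1C; rewrite mulmxA -BE mulmxV.
have [Vu _] := mulmx1_unit VBD.
have VE := mulmx1_invmx _ _ _ _ VBD.
split=> //.
have UV : V *m V^T *m ((invmx V)^T *m invmx V) = 1%:M.
  by rewrite trmx_inv mulmxA mulmxK ?unitmx_tr // mulmxV.
rewrite (mulmx1_invmx _ _ _ _ UV).
apply: eq_bigr => i _.
(* Only the dual norm stays expanded; the factor [enorm (row i B) ^+ 2] is moved into its sum, to
   match the squared entries of [V^-1 = B^-1 D]. *)
rewrite -{2}[invmx V]trmxK mulmx_tr_diag !enorm_sqr -enorm_sqr mulr_sumr.
apply: eq_bigr => j _; rewrite VE /D /row_norm_mx mul_mx_diag -exprMn.
by rewrite !mxE mulrC.
Qed.

Theorem corollary3p3 (R : realType) (n : nat) (L : set 'rV[R]_n)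
    (B V : 'M[R]_n) :
  full_lattice L ->
  lattice_basis L B ->
  B = row_norm_mx B *m V ->
  let U := V *m V^T in
  [/\ posdefmx U,
      exists lam : 'I_n -> R, eigenvalues_of U lam
    & forall lam : 'I_n -> R, eigenvalues_of U lam ->
        [/\ forall i : 'I_n, 0 < lam i,
            seysen B = \tr (invmx U)
          & \tr (invmx U) = \sum_(i < n) (lam i)^-1]].
Proof.
move=> _ [Bfree _] BE U.
have Bu : B \in unitmx by rewrite -row_free_unit.
have [Vu seysenE] := seysen_mxtrace _ _ _ _ Bu BE.
have Upos : posdefmx U by apply: posdefmx_mulmx_tr.
have [Usym _] := Upos.
have [_ [d [_ _ Ud]]] := symmetric_diagonalizable _ _ _ Usym.
split=> //; first by exists (d 0).
move=> lam Ulam; split=> //; last first.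
  by apply: mxtrace_invmx_symmetric => //; rewrite unitmx_mul unitmx_tr Vu.
move=> i; apply: posdefmx_eigenvalue_gt0 Upos _.
(* The [i]-th factor of the characteristic polynomial vanishes at [lam i]. *)
rewrite eigenvalue_root_char Ulam rootE horner_prod (bigD1 i) //=.
by rewrite hornerXsubC subrr mul0r.
Qed.
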